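(* For every field $\Bbbk$ and every positive integer $n$, the semigroup algebra $\Bbbk\mathcal{OF}_{n}$ is semisimple.
   Context: $[n]=\{1,\ldots,n\}$. $\mathcal{OF}_n$ is the monoid (under composition of functions, right to left) of all order-preserving functions $f:[n]\to[n]$ (i.e. $i_1\le i_2$ implies $f(i_1)\le f(i_2)$) such that $f(n)=n$. $\Bbbk S$ denotes the semigroup algebra of $S$ over $\Bbbk$. *)

(* Defs.v *)
From HB Require Import structures.
From mathcomp Require Import all_boot all_order all_algebra all_field.
From mathcomp Require Import finmap.
From mathcomp.multinomials Require Import monalg.

Set Implicit Arguments.
Unset Strict Implicit.
Unset Printing Implicit Defensive.

Import GRing.Theory.
Local Open Scope ring_scope.

Section Semisimple.

Variables (K : fieldType) (A : falgType K).

(* A left ideal of a unital algebra is automatically a linear subspace, so the *)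
(* submodules of the left regular module are exactly the following subspaces.  *)
Definition left_ideal (V : {vspace A}) : bool := (fullv * V <= V)%VS.

Definition simple_left_ideal (V : {vspace A}) : Prop :=
  [/\ left_ideal V, V != 0%VS
    & forall U : {vspace A},
        left_ideal U -> (U <= V)%VS -> U = 0%VS \/ U = V].

(* The left regular module is a direct sum of simple modules; the family can   *)
(* be taken finite because A is finite dimensional.                            *)
Definition semisimple_algebra : Prop :=
  exists (m : nat) (V : 'I_m -> {vspace A}),
    [/\ forall i, simple_left_ideal (V i),
        directv (\sum_(i < m) V i)
      & (\sum_(i < m) V i)%VS = fullv].

End Semisimple.

Section OrderPreserving.

Variable n : nat.

(* 'I_n is [n] shifted by one: its last element is the i with i.+1 = n. *)
Definition is_OF (f : {ffun 'I_n -> 'I_n}) : bool :=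
  [forall i : 'I_n, forall j : 'I_n, (i <= j)%N ==> (f i <= f j)%N]
  && [forall i : 'I_n, (i.+1 == n) ==> (f i == i)].

Record OF : predArgType :=
  MkOF { OF_fun :> {ffun 'I_n -> 'I_n}; _ : is_OF OF_fun }.

HB.instance Definition _ := [isSub for OF_fun].
HB.instance Definition _ := [Finite of OF by <:].

Lemma OF_homo (f : OF) (i j : 'I_n) : (i <= j)%N -> (f i <= f j)%N.
Proof. by case: f => f /= /andP[/forallP/(_ i)/forallP/(_ j)/implyP fP _] /fP. Qed.

Lemma OF_last (f : OF) (i : 'I_n) : i.+1 = n -> f i = i.
Proof. by case: f => f /= /andP[_ /forallP/(_ i)/implyP fP] /eqP/fP/eqP. Qed.

Lemma OFP (f g : OF) : (forall i, f i = g i) <-> f = g.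
Proof. by split=> [fg | -> //]; apply/val_inj/ffunP. Qed.

Fact OF_id_proof : is_OF [ffun i => i].
Proof.
apply/andP; split; last by apply/forallP=> i; rewrite ffunE eqxx implybT.
by apply/forallP=> i; apply/forallP=> j; rewrite !ffunE implybb.
Qed.
Definition OF_id : OF := MkOF OF_id_proof.

Fact OF_comp_proof (f g : OF) : is_OF [ffun i => f (g i)].
Proof.
apply/andP; split.
  apply/forallP=> i; apply/forallP=> j; rewrite !ffunE.
  by apply/implyP=> ij; do 2!apply: OF_homo.
by apply/forallP=> i; rewrite ffunE; apply/implyP=> /eqP li; rewrite !OF_last.
Qed.
Definition OF_comp (f g : OF) : OF := MkOF (OF_comp_proof f g).

Lemma OF_idE i : OF_id i = i. Proof. by rewrite ffunE. Qed.
Lemma OF_compE f g i : OF_comp f g i = f (g i). Proof. by rewrite ffunE. Qed.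

Lemma OF_compA : associative OF_comp.
Proof. by move=> f g h; apply/OFP=> i; rewrite !OF_compE. Qed.

Lemma OF_comp1f : left_id OF_id OF_comp.
Proof. by move=> f; apply/OFP=> i; rewrite OF_compE OF_idE. Qed.

Lemma OF_compf1 : right_id OF_id OF_comp.
Proof. by move=> f; apply/OFP=> i; rewrite OF_compE OF_idE. Qed.

Lemma OF_inj_id (f : OF) : injective f -> f = OF_id.
Proof.
move=> f_inj; suff fE k (i : 'I_n) : (i < k)%N -> f i = i.
  by apply/OFP=> i; rewrite OF_idE (fE i.+1).
elim: k i => // k IHk i; rewrite ltnS leq_eqVlt => /predU1P[ik | /IHk //].
have [g gK fK] := injF_bij f_inj.
apply/val_inj/eqP; rewrite eqn_leq; apply/andP; split.
  rewrite -{2}(fK i); apply: OF_homo; rewrite leqNgt; apply/negP=> gi.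
  have /IHk Eg : (g i < k)%N by rewrite -ik.
  by move: gi; rewrite -{2}(fK i) Eg ltnn.
rewrite leqNgt; apply/negP=> fi.
have /IHk/f_inj E : (f i < k)%N by rewrite -ik.
by move: fi; rewrite E ltnn.
Qed.

(* The monoids of the library are required to have a trivial group of units.   *)
Lemma OF_unit f g : OF_comp f g = OF_id -> f = OF_id /\ g = OF_id.
Proof.
move=> fg1; have gK : cancel g f by move=> i; rewrite -OF_compE fg1 OF_idE.
have g1 := OF_inj_id (can_inj gK); split=> //.
by rewrite -fg1 g1 OF_compf1.
Qed.

HB.instance Definition _ :=
  Choice_isMonomialDef.Build OF OF_compA OF_comp1f OF_compf1 OF_unit.

End OrderPreserving.

Lemma malg_scaleAr (K : comNzRingType) (M : monomType) (c : K)
  (x y : {malg K[M]}) : c *: (x * y) = x * (c *: y).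
Proof.
apply/malgP=> k; rewrite mcoeffZ.
rewrite (mcoeffMlw _ (fsubset_refl _) (fsubset_refl _)).
rewrite (mcoeffMlw _ (fsubset_refl _) (msuppZ_le _ _)).
rewrite mulr_sumr; apply: eq_bigr => i _; rewrite mulr_sumr.
by apply: eq_bigr => j _; rewrite mcoeffZ mulrnAr mulrCA.
Qed.

Lemma malg_vect_axiom (K : nzRingType) (M : finType) :
  Vector.axiom #|M| {malg K[M]}.
Proof.
exists (fun x : {malg K[M]} => \row_i x@_(enum_val i)).
  by move=> c x y; apply/rowP=> i; rewrite !mxE mcoeffD mcoeffZ.
exists (fun r : 'rV[K]_#|M| => \sum_i << r 0 i *g enum_val i >> : {malg K[M]}).
  move=> x; apply/malgP=> k; rewrite raddf_sum (bigD1 (enum_rank k)) //=.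
  rewrite mcoeffU mxE enum_rankK eqxx big1 ?addr0 // => i.
  by rewrite mcoeffU -(inj_eq enum_val_inj) enum_rankK => /negPf->.
move=> r; apply/rowP=> j; rewrite mxE raddf_sum (bigD1 j) //= mcoeffU eqxx.
by rewrite big1 ?addr0 // => i; rewrite mcoeffU (inj_eq enum_val_inj) => /negPf->.
Qed.

(* An alias of the monoid ring {malg K[OF n]}, because the library provides    *)
(* {malg _} with an algebra structure only for commutative monoids.            *)
Definition OFalg (K : fieldType) (n : nat) : Type := {malg K[OF n]}.

Section OFAlgebra.

Variables (K : fieldType) (n : nat).
Local Notation A := (OFalg K n).

HB.instance Definition _ := GRing.Lalgebra.on A.
HB.instance Definition _ :=
  GRing.Lalgebra_isAlgebra.Build K A (@malg_scaleAr K (OF n)).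
HB.instance Definition _ :=
  Lmodule_hasFinDim.Build K A (malg_vect_axiom K (OF n)).
HB.instance Definition _ := Algebra_isFalgebra.Build K A.

End OFAlgebra.

(* Main.v *)
Require Import Defs.
From mathcomp Require Import all_boot all_order all_algebra all_field.
From HB Require Import structures.
From mathcomp.multinomials Require Import monalg.

(** The algebra is a product of full matrix algebras, one for each exterior
    power of the reduced natural module.  A map [f] fixing the last point acts
    on the span of the points modulo the last one, hence on the exterior powers
    of this quotient.  Their natural basis is indexed by the sets [S] of points
    that contain the last point (which stands for the zero vector), and since
    [f] preserves the order no sign appears: [f] sends [S] to [f @: S] when [f]
    is injective on [S], and to 0 otherwise.  This is the relation [moves], and
    [rep T S x] is the resulting matrix coefficient of an element [x] of the
    algebra.

    Two sets are [linked] when some map moves one to the other; in this monoid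
    the relation is symmetric, because a map injective on [S] can be inverted
    on [S] by another map of the monoid ([OF_inverse_on]).  So the image of the algebra lies in
    the span of the matrix units at linked places, and the point is that this
    representation identifies the two.  The reason is triangularity.  To [f]
    attach the set [tops f] of the greatest elements of its fibres.  It is the
    heaviest set on which [f] is injective, for the weight that adds up the
    positions of the points, since any other such set is pushed upwards into
    [tops f] ([weight_tops]).  Hence the matrix of [f] is one matrix unit, in
    column [tops f], plus matrix units in columns of smaller weight.  Moreover
    [f] is determined by its leading matrix unit ([eq_OF_tops], [eq_moves]),
    and every linked place is the leading one for some [f] ([tops_of_moves]).
    The coefficients on the diagonal are all 1, so the characteristic of the
    field is irrelevant.  Injectivity is [rep_inj] and the presence of all the
    matrix units in the image is [rep_unit_exists].

    An algebra spanned by such matrix units is the direct sum of its columns,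
    which are minimal left ideals ([semisimple_matrix_units]). *)

Set Implicit Arguments.
Unset Strict Implicit.
Unset Printing Implicit Defensive.

Import GRing.Theory.
Local Open Scope ring_scope.

(** * Algebras spanned by matrix units *)

Section MatrixUnits.

Variables (K : fieldType) (A : falgType K) (J : finType).
Variables (e : rel J) (E : J -> J -> A).

Hypothesis e_sym : symmetric e.
Hypothesis e_trans : transitive e.
Hypothesis E_mul : forall T S R Q, e T S -> e R Q ->
  E T S * E R Q = if S == R then E T Q else 0.
Hypothesis E_neq0 : forall S, e S S -> E S S != 0.
Hypothesis E_span :
  forall x : A, x \in (\sum_(p : J * J | e p.1 p.2) <[E p.1 p.2]>)%VS.

Let column (S : J) : {vspace A} := (\sum_(T | e T S) <[E T S]>)%VS.

Lemma mem_column T S : e T S -> E T S \in column S.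
Proof.
by move=> eTS; apply: (subvP (sumv_sup T eTS (subvv _))); apply: memv_line.
Qed.

(** Right multiplication by the diagonal units projects onto the columns, which
    is why their sum is direct. *)
Lemma column_mulr S R (x : A) : e R R -> x \in column S ->
  x * E R R = if S == R then x else 0.
Proof.
move=> eRR /memv_sumP[v vP ->]; rewrite mulr_suml.
have vE T : e T S -> v T * E R R = if S == R then v T else 0.
  move=> eTS; have /vlineP[c ->] := vP T eTS; rewrite -scalerAl E_mul //.
  by case: eqP => [->|_]; rewrite ?scaler0.
rewrite (eq_bigr _ vE); case: eqP => // _.
by rewrite big1.
Qed.

Lemma column_left_ideal S : left_ideal (column S).
Proof.
apply/prodvP => u v _ /memv_sumP[w wP ->].
have /memv_sumP[z zP ->] := E_span u.
rewrite mulr_suml; apply: memv_suml => -[T R] /= eTR.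
rewrite mulr_sumr; apply: memv_suml => Q eQS.
have /vlineP[c ->] := zP (T, R) eTR; have /vlineP[d ->] := wP Q eQS.
rewrite -scalerAl -scalerAr !memvZ //= E_mul //.
case: eqP => [RQ|_]; last exact: mem0v.
by apply: mem_column; apply: e_trans eTR _; rewrite RQ.
Qed.

(** One nonzero coordinate of an element of a column can be moved by a matrix
    unit to any other place of that column, so the element generates it. *)
Lemma column_simple S : e S S -> simple_left_ideal (column S).
Proof.
move=> eSS; split; first exact: column_left_ideal.
  apply: contraNneq (E_neq0 eSS) => col0.
  by have := mem_column eSS; rewrite col0 memv0.
move=> U /prodvP Uideal sUcol; case: (eqVneq U 0%VS) => [|nzU]; [by left|right].
apply/eqP; rewrite eqEsubv sUcol /=.
have xU := memv_pick U; have := subvP sUcol _ xU.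
set x := vpick U in xU *; move=> /memv_sumP[v vP xE].
have nzx : x != 0 by rewrite /x vpick0.
have [T /andP[eTS nzvT]] : exists T, e T S && (v T != 0).
  apply/existsP; apply: contraNT nzx; rewrite negb_exists => /forallP v0.
  rewrite xE big1 // => T eTS; apply/eqP.
  by have := v0 T; rewrite eTS /= negbK.
have /vlineP[c vT] := vP T eTS.
have nzc : c != 0 by apply: contraNneq nzvT => c0; rewrite vT c0 scale0r.
apply/subv_sumP => R eRS; rewrite -memvE.
have eRT : e R T by apply: e_trans eRS _; rewrite e_sym.
suff Ex : E R T * x = c *: E R S.
  have := Uideal (E R T) x (memvf _) xU.
  by rewrite Ex rpredZeq (negPf nzc).
rewrite xE mulr_sumr (bigD1 T) //= big1 ?addr0.
  by rewrite vT -scalerAr E_mul // eqxx.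
move=> Q /andP[eQS QT]; have /vlineP[d ->] := vP Q eQS.
by rewrite -scalerAr E_mul // eq_sym (negPf QT) scaler0.
Qed.

(** The relation [e] need not be reflexive on [J]: the columns that occur are
    those of its field, and [e] is an equivalence there. *)
Lemma semisimple_matrix_units : semisimple_algebra A.
Proof.
pose D := [pred S | e S S].
exists #|D|, (fun i => column (enum_val i)).
have eD (i : 'I_#|D|) : e (enum_val i) (enum_val i) by have := enum_valP i.
split=> [i||]; first exact: column_simple.
- apply/directv_sum_independent => u uP u0 i _.
  have := congr1 (fun x => x * E (enum_val i) (enum_val i)) u0.
  rewrite mul0r mulr_suml (bigD1 i) //= big1 ?addr0.
    by rewrite (column_mulr (eD i) (uP i isT)) eqxx.
  move=> j ji; rewrite (column_mulr (eD i) (uP j isT)).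
  by rewrite (inj_eq enum_val_inj) (negPf ji).
- apply/eqP; rewrite eqEsubv subvf /= -(big_enum_val column).
  apply/subvP => x _; apply: (subvP _ x (E_span x)).
  apply/subv_sumP => -[T S] /= eTS.
  have eST : e S T by rewrite e_sym.
  have eSS := e_trans eST eTS.
  apply: (@sumv_sup _ _ _ S) => //.
  by rewrite -memvE; apply: mem_column.
Qed.

End MatrixUnits.

(** * Order-preserving maps moving sets of points *)

Section Combinatorics.

Variable n : nat.
Local Notation I := 'I_n.+1.
Local Notation OFn := (OF n.+1).
Implicit Types (f g h : OFn) (S T R : {set I}).

(** With [T == f @: S], the equality of cardinals says that [f] is injective on
    [S].  Requiring the last point in [S] makes this also say that no other
    point of [S] is sent to the last one. *)
Definition moves f S T := [&& ord_max \in S, #|T| == #|S| & T == f @: S].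

Lemma movesP f S T :
  reflect [/\ ord_max \in S, {in S &, injective f} & T = f @: S] (moves f S T).
Proof.
apply: (iffP and3P) => [[mS /eqP cTS /eqP TE]|[mS /imset_injP/eqP cfS ->]].
  by split=> //; apply/imset_injP; rewrite -cTS TE.
by split; rewrite // cfS.
Qed.

Lemma OF_max f : f ord_max = ord_max.
Proof. exact: OF_last. Qed.

Lemma OF_lt f (i j : I) : (f i < f j)%N -> (i < j)%N.
Proof. by rewrite !ltnNge; apply: contraNN; apply: OF_homo. Qed.

Lemma moves_comp f g S T :
  moves (OF_comp f g) S T = moves g S (g @: S) && moves f (g @: S) T.
Proof.
have fgE i : OF_comp f g i = f (g i) by rewrite OF_compE.
have imE : OF_comp f g @: S = f @: (g @: S).
  by rewrite -imset_comp; apply: eq_imset => i /=.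
apply/movesP/andP => [[mS inj ->]|[/movesP[mS injg _] /movesP[_ injf ->]]].
  have injg : {in S &, injective g}.
    by move=> i j iS jS gij; apply: inj; rewrite // !fgE gij.
  split; apply/movesP; split=> //.
    by apply/imsetP; exists ord_max => //; rewrite OF_max.
  move=> _ _ /imsetP[i iS ->] /imsetP[j jS ->] fgij.
  by rewrite (inj i j) // !fgE.
split=> // i j iS jS; rewrite !fgE => /injf gij.
by apply: injg => //; apply: gij; apply: imset_f.
Qed.

(** The map [h] is the left adjoint of the restriction of [g] to [S]: it sends
    [j] to the least [s] in [S] with [j <= g s].  Injectivity is what makes [h]
    fix the last point, as [g] then sends no smaller point of [S] there. *)
Lemma OF_inverse_on g S : ord_max \in S -> {in S &, injective g} ->
  exists h, [/\ forall j, h j \in S, forall j : I, (j <= g (h j))%N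
              & {in S, cancel g h}].
Proof.
move=> mS injg.
pose P (j : I) := [pred s : I | (s \in S) && (j <= g s)%N].
have Pmax j : P j ord_max by rewrite /= mS OF_max; apply: leq_ord.
pose h0 : {ffun I -> I} := [ffun j => [arg min_(s < ord_max | P j s) s]].
have h0P j : [/\ h0 j \in S, (j <= g (h0 j))%N
      & forall s, s \in S -> (j <= g s)%N -> (h0 j <= s)%N].
  rewrite ffunE; case: arg_minnP; first exact: Pmax.
  move=> s /andP[sS js] min_s; split=> // t tS jt.
  by apply: min_s; rewrite /= tS.
have gK : {in S, cancel g h0}.
  move=> s sS; have [hS gh hmin] := h0P (g s).
  apply: injg => //; apply/val_inj/anti_leq; rewrite gh andbT.
  by apply: OF_homo; apply: hmin.
have hOF : is_OF h0.
  apply/andP; split.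
    apply/forallP=> i; apply/forallP=> j; apply/implyP=> ij.
    have [hiS _ himin] := h0P i; have [hjS jg _] := h0P j.
    by apply: himin => //; apply: leq_trans jg.
  apply/forallP=> i; apply/implyP=> /eqP [im].
  have -> : i = ord_max by apply: val_inj.
  by rewrite -{1}(OF_max g) gK.
by exists (MkOF hOF); split=> j; have [] := h0P j => // *; apply: gK.
Qed.

Definition linked T S := [exists f : OFn, moves f S T].

Lemma linked_sym : symmetric linked.
Proof.
suff half T S : linked T S -> linked S T.
  by move=> T S; apply/idP/idP; apply: half.
case/existsP=> f /movesP[mS injf ->].
have [h [_ _ fK]] := OF_inverse_on mS injf.
apply/existsP; exists h; apply/movesP; split.
- by apply/imsetP; exists ord_max; rewrite ?OF_max.
- move=> _ _ /imsetP[i iS ->] /imsetP[j jS ->].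
  by rewrite !fK // => ->.
- apply/setP => i; apply/idP/imsetP => [iS|[_ /imsetP[j jS ->] ->]].
    by exists (f i); rewrite ?imset_f ?fK.
  by rewrite fK.
Qed.

Lemma linked_trans : transitive linked.
Proof.
move=> T S R /existsP[f /movesP[mT injf ->]] /existsP[g /movesP[mR injg TE]].
apply/existsP; exists (OF_comp f g); rewrite moves_comp -TE.
by apply/andP; split; apply/movesP.
Qed.

(** Between two finite chains there is only one increasing bijection.  At the
    least point [i] where two of them differ, with [f' i < g' i], the value
    [f' i] would have to be taken by [g'] at a smaller point, where they agree. *)
Lemma eq_moves f g S T : moves f S T -> moves g S T -> {in S, f =1 g}.
Proof.
have le k f' g' : moves f' S T -> moves g' S T ->
    forall i : I, (i < k)%N -> i \in S -> f' i = g' i.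
  elim: k f' g' => // k IH f' g' mf mg i; rewrite ltnS => ik iS.
  wlog fg : f' g' mf mg / (f' i < g' i)%N.
    move=> W; have [/W->//|/W->//|/val_inj//] := ltngtP (f' i) (g' i).
  have /movesP[_ injf TE] := mf; have /movesP[_ _ TE'] := mg.
  have : f' i \in g' @: S by rewrite -TE' TE imset_f.
  case/imsetP=> j jS fj; have ji : (j < i)%N by apply: (@OF_lt g'); rewrite -fj.
  have := IH f' g' mf mg j (leq_trans ji ik) jS.
  by rewrite -fj => /injf E; move: ji; rewrite E ?ltnn.
by move=> mf mg i; apply: (le n.+1).
Qed.

Definition tops f : {set I} := [set i | [forall j, (f j == f i) ==> (j <= i)%N]].

Lemma topsP f i :
  reflect (forall j, f j = f i -> (j <= i)%N) (i \in tops f).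
Proof.
rewrite inE; apply: (iffP forallP) => [H j /eqP fj|H j].
  exact: (implyP (H j)).
by apply/implyP => /eqP; apply: H.
Qed.

Lemma top_exists f (i : I) : exists j, [/\ j \in tops f, (i <= j)%N & f j = f i].
Proof.
case: (@arg_maxnP _ i [pred j | f j == f i] (@nat_of_ord _)); first exact: eqxx.
move=> j /eqP fj max_j; exists j; split=> //; last exact: max_j (eqxx _).
by apply/topsP => k; rewrite fj => fk; apply: max_j; rewrite /= fk.
Qed.

Lemma tops_inj f : {in tops f &, injective f}.
Proof.
move=> i j /topsP it /topsP jt fij; apply/val_inj/anti_leq.
by rewrite jt //= it.
Qed.

Lemma moves_tops f : moves f (tops f) (f @: tops f).
Proof.
apply/movesP; split=> //; last exact: tops_inj.
by apply/topsP => j _; apply: leq_ord.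
Qed.

(** On a fibre of [g] the value is taken at its top [j >= i], where [f] agrees
    with [g], so [f i <= f j = g i]; then exchange [f] and [g]. *)
Lemma eq_OF_tops f g : tops f = tops g -> {in tops f, f =1 g} -> f = g.
Proof.
have le f' g' : tops f' = tops g' -> {in tops f', f' =1 g'} ->
    forall i : I, (f' i <= g' i)%N.
  move=> tfg fg i; have [j [jt ij <-]] := top_exists g' i.
  by rewrite -fg ?tfg //; apply: OF_homo.
move=> tfg fg; apply/OFP => i; apply/val_inj/anti_leq; rewrite !le //.
by move=> j jt; rewrite fg // tfg.
Qed.

(** Precompose [g] with the retraction [h] onto [S] that rounds upwards: the
    fibres of the composite are those of [h], whose tops are the points of [S]. *)
Lemma tops_of_moves g S T : moves g S T -> exists2 f, moves f S T & tops f = S.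
Proof.
case/movesP=> mS injg ->.
have inj1 : {in S &, injective (OF_id n.+1)} by move=> i j _ _; rewrite !OF_idE.
(* The left adjoint of the inclusion of [S] is the retraction rounding upwards. *)
have [h [hS hle hK]] := OF_inverse_on mS inj1.
have {}hK : {in S, forall s, h s = s} by move=> s /hK; rewrite OF_idE.
have {}hle (j : I) : (j <= h j)%N by have := hle j; rewrite OF_idE.
have fE i : OF_comp g h i = g (h i) by rewrite OF_compE.
exists (OF_comp g h).
  apply/movesP; split=> //.
    by move=> i j iS jS; rewrite !fE !hK //; apply: injg.
  by apply: eq_in_imset => i iS; rewrite fE hK.
apply/setP => i; apply/topsP/idP => [it|iS j].
  suff -> : i = h i by [].
  by apply/val_inj/anti_leq; rewrite hle it // !fE hK.
by rewrite !fE (hK i) // => /(injg _ _ (hS j) iS) <-.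
Qed.

(** The successor makes every point count, so that the weight increases with
    the set as well as with its elements. *)
Definition weight S := (\sum_(s in S) s.+1)%N.

Lemma weight_sub S T : S \subset T -> (weight S <= weight T ?= iff (S == T))%N.
Proof.
move=> sST; rewrite /weight; split.
  by rewrite [leqRHS](big_setID S) (setIidPr sST) leq_addr.
apply/eqP/eqP => [|->//].
rewrite [in RHS](big_setID S) (setIidPr sST) => /eqP.
rewrite -[X in X == _]addn0 eqn_add2l eq_sym sum_nat_eq0 => /forallP T0.
apply/eqP; rewrite eqEsubset sST -setD_eq0; apply/eqP/setP => i.
by rewrite in_set0; apply/negP => iTS; have := T0 i; rewrite iTS.
Qed.

(** Sending each point to the top of its fibre is injective on [S] and does not
    decrease any point; equality of weights forces every point of [S] to be a
    top and every top to be reached. *)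
Lemma weight_tops f S : {in S &, injective f} -> S != tops f ->
  (weight S < weight (tops f))%N.
Proof.
move=> injf; have [top topP] := fin_all_exists (top_exists f).
have injt : {in S &, injective top}.
  move=> i j iS jS tij; apply: injf => //.
  by have [_ _ <-] := topP i; have [_ _ <-] := topP j; rewrite tij.
have sub : top @: S \subset tops f.
  by apply/subsetP => _ /imsetP[i _ ->]; have [] := topP i.
have wS : (weight S <= weight (top @: S) ?= iff [forall s in S, s == top s])%N.
  rewrite {2}/weight big_imset //; apply: leqif_sum => i _.
  have [_ it _] := topP i; split=> //.
have [le eq] := leqif_trans wS (weight_sub sub).
rewrite ltn_neqAle le andbT eq; apply: contraNN => /andP[/forallP fixt /eqP <-].
apply/eqP/setP=> i; apply/idP/imsetP => [iS|[j jS ->]].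
  by exists i => //; apply/eqP; have := fixt i; rewrite iS.
by have := fixt j; rewrite jS => /eqP <-.
Qed.

End Combinatorics.

(** * Matrix coefficients of the semigroup algebra *)

Lemma malg_expand (R : nzRingType) (M : finType) (z : {malg R[M]}) :
  z = \sum_m z@_m *: << m >>.
Proof.
apply/malgP => k; rewrite raddf_sum (bigD1 k) //= mcoeffZ mcoeffU eqxx.
rewrite mulr1 big1 ?addr0 // => m mk.
by rewrite mcoeffZ mcoeffU (negPf mk) mulr0.
Qed.

Section Representation.

Variables (K : fieldType) (n : nat).
Local Notation I := 'I_n.+1.
Local Notation OFn := (OF n.+1).
Local Notation A := (OFalg K n.+1).
Implicit Types (f g h : OFn) (S T R : {set I}) (x y : A).

Definition basis f : A := << f >>.

Lemma coeff_basis f g : (basis f)@_g = (f == g)%:R.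
Proof. exact: mcoeffU1. Qed.

Lemma basis_mul f g : basis f * basis g = basis (OF_comp f g).
Proof.
have U : << f >> * << g >> = << (1 * 1 : K) *g OF_comp f g >> :> {malg K[OFn]}.
  by rewrite malgM_def; apply: fgmulUU.
by rewrite mulr1 in U.
Qed.

Lemma basis_expand x : x = \sum_f x@_f *: basis f.
Proof. exact: malg_expand. Qed.

Definition rep T S x : K := \sum_f x@_f * (moves f S T)%:R.

Lemma rep_is_linear T S : scalar (rep T S).
Proof.
move=> c x y; rewrite /rep mulr_sumr -big_split; apply: eq_bigr => f _ /=.
by rewrite mcoeffD mcoeffZ mulrDl mulrA.
Qed.

HB.instance Definition _ T S :=
  GRing.isLinear.Build K A K *%R (rep T S) (@rep_is_linear T S).

Lemma rep_basis T S f : rep T S (basis f) = (moves f S T)%:R.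
Proof.
rewrite /rep (bigD1 f) //= coeff_basis eqxx mul1r big1 ?addr0 // => g gf.
by rewrite coeff_basis eq_sym (negPf gf) mul0r.
Qed.

Lemma rep_unlinked T S x : ~~ linked T S -> rep T S x = 0.
Proof.
rewrite negb_exists => /forallP no; rewrite /rep big1 // => f _.
by rewrite (negPf (no f)) mulr0.
Qed.

Lemma rep_basis_mul T R f g :
  rep T R (basis f * basis g) = \sum_S rep T S (basis f) * rep S R (basis g).
Proof.
rewrite basis_mul rep_basis moves_comp (bigD1 (g @: R)) //= !rep_basis.
rewrite big1 ?addr0 => [|S SgR]; first by rewrite -natrM mulnb andbC.
by rewrite !rep_basis [moves g R S]/moves (negPf SgR) !andbF mulr0.
Qed.

Lemma rep_mul T R x y : rep T R (x * y) = \sum_S rep T S x * rep S R y.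
Proof.
rewrite (basis_expand x) (basis_expand y).
transitivity (\sum_f \sum_g x@_f * (y@_g * rep T R (basis f * basis g))).
  rewrite mulr_suml raddf_sum /=; apply: eq_bigr => f _.
  rewrite mulr_sumr raddf_sum /=; apply: eq_bigr => g _.
  by rewrite -scalerAl -scalerAr !linearZ.
under [RHS]eq_bigr => S _ do rewrite !raddf_sum mulr_suml /=.
rewrite [RHS]exchange_big; apply: eq_bigr => f _ /=.
under [RHS]eq_bigr => S _ do rewrite mulr_sumr /=.
rewrite [RHS]exchange_big; apply: eq_bigr => g _ /=.
rewrite rep_basis_mul !mulr_sumr; apply: eq_bigr => S _.
by rewrite !linearZ /= mulrACA mulrA.
Qed.

(** Among the maps in the support of [x], take [f] with [tops f] of maximal
    weight.  Any other [g] in the support contributing to the leading place of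
    [f] is injective on [tops f], so by maximality has the same tops, and then
    it equals [f].  The coefficient of [x] at [f] is thus a matrix coefficient. *)
Lemma rep_inj x : (forall T S, rep T S x = 0) -> x = 0.
Proof.
move=> x0; apply/malgP => f0; rewrite mcoeff0; apply/eqP/contraT => xf0.
pose P f := x@_f != 0.
have [f xf fmax] := @arg_maxnP _ f0 P (fun f => weight (tops f)) xf0.
apply: contraNT xf => _; rewrite -[X in _ == X](x0 (f @: tops f) (tops f)).
rewrite /rep (bigD1 f) //= moves_tops mulr1 big1 ?addr0 // => g gf.
have [->|xg] := eqVneq x@_g 0; first by rewrite mul0r.
case: (boolP (moves _ _ _)) => [mg|]; last by rewrite mulr0.
have [tfg|/weight_tops lt] := eqVneq (tops f) (tops g).
  have E := eq_moves (moves_tops f) mg.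
  by rewrite (eq_OF_tops tfg E) eqxx in gf.
have /movesP[_ injg _] := mg.
by have := leq_trans (lt injg) (fmax g xg); rewrite ltnn.
Qed.

Lemma rep_eq x y : (forall T S, rep T S x = rep T S y) -> x = y.
Proof.
move=> xy; apply/eqP; rewrite -subr_eq0; apply/eqP/rep_inj => T S.
by rewrite raddfB /= xy subrr.
Qed.

(** Gaussian elimination along the weight: take [f] with leading place [(T, S)]
    and subtract the other matrix units of [f], which lie in columns of smaller
    weight. *)
Lemma rep_unit_exists T S : exists x, linked T S ->
  forall T' S', rep T' S' x = ((T' == T) && (S' == S))%:R.
Proof.
have [k] := ubnP (weight S); elim: k T S => // k IH T S.
rewrite ltnS => wS; case: (boolP (linked T S)) => [|_]; last by exists 0.
case/existsP=> g /tops_of_moves[f mf tf].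
(* The trivial value 0 is used outside the columns to be subtracted, so that
   a unit can be chosen for all [S'] at once. *)
have IHf S' : exists x, moves f S' (f @: S') -> S' != S ->
    forall T1 S1, rep T1 S1 x = ((T1 == f @: S') && (S1 == S'))%:R.
  case: (boolP (moves f S' (f @: S'))) => [mf'|_]; last by exists 0.
  have [->|S'S] := eqVneq S' S; first by exists 0.
  have /movesP[_ injf _] := mf'.
  have lt : (weight S' < k)%N.
    by apply: leq_trans wS; rewrite -tf; apply: weight_tops; rewrite ?tf.
  have [x xP] := IH (f @: S') S' lt; exists x => _ _; apply: xP.
  by apply/existsP; exists f.
have [u uP] := fin_all_exists IHf.
exists (basis f - \sum_(S' | moves f S' (f @: S') && (S' != S)) u S') => _ T1 S1.
have TE : T = f @: S by case/movesP: mf.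
rewrite raddfB [X in _ - X]raddf_sum /= rep_basis.
have -> : \sum_(S' | moves f S' (f @: S') && (S' != S)) rep T1 S1 (u S')
    = (moves f S1 T1 && (S1 != S))%:R.
  under eq_bigr => S' /andP[mS' S'S] do rewrite uP //.
  have [->|TS1] := eqVneq T1 (f @: S1); last first.
    rewrite [moves f S1 T1]/moves (negPf TS1) !andbF.
    rewrite big1 // => S' _; case: andP => // -[/eqP T1E /eqP S1E].
    by rewrite T1E S1E eqxx in TS1.
  case: (boolP (_ && _)) => [mS1|].
    rewrite (bigD1 S1) //= !eqxx big1 ?addr0 // => S' /andP[_ S'S1].
    by rewrite [S1 == _]eq_sym (negPf S'S1) andbF.
  move=> mS1; rewrite big1 // => S' mS'; case: andP => // -[_ /eqP S1E].
  by rewrite S1E mS' in mS1.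
have [->|S1S] := eqVneq S1 S; last by rewrite !andbT !andbF subrr.
rewrite andbF subr0 andbT; congr (_%:R); congr nat_of_bool.
apply/idP/eqP => [/movesP[_ _ ->]|->]; by rewrite -?TE.
Qed.

End Representation.

Theorem lemma4p8 (K : fieldType) (n : nat) (hn : (0 < n)%N) :
  semisimple_algebra (OFalg K n).
Proof.
case: n hn => // n _.
have [E EP] : exists E : {set 'I_n.+1} -> {set 'I_n.+1} -> OFalg K n.+1,
    forall T S, linked T S ->
      forall T' S', rep T' S' (E T S) = ((T' == T) && (S' == S))%:R.
  have H T := fin_all_exists (@rep_unit_exists K n T).
  by have [E EP] := fin_all_exists H; exists E.
(* All the identities between matrix units are checked on matrix coefficients. *)
apply: (@semisimple_matrix_units _ _ _ (@linked n) E).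
- exact: linked_sym.
- exact: linked_trans.
- move=> T S R Q lTS lRQ; apply: rep_eq => T' Q'; rewrite rep_mul.
  rewrite (bigD1 S) //= !EP // eqxx andbT big1 ?addr0; last first.
    by move=> S' S'S; rewrite EP // (negPf S'S) andbF mul0r.
  have [SR|SR] := eqVneq S R; last by rewrite mulr0 raddf0.
  rewrite EP; last by apply: linked_trans lTS _; rewrite SR.
  by rewrite -natrM mulnb.
- move=> S lSS; apply: contraTneq isT => ES0.
  have := EP S S lSS S S; rewrite ES0 raddf0 !eqxx => /eqP.
  by rewrite eq_sym oner_eq0.
- move=> x; set V := (X in x \in X).
  have -> : x = \sum_(p : _ * _ | linked p.1 p.2) rep p.1 p.2 x *: E p.1 p.2.
    apply: rep_eq => T S; rewrite raddf_sum /=.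
    case: (boolP (linked T S)) => lTS.
      rewrite (bigD1 (T, S)) //= linearZ /= EP // !eqxx mulr1 big1 ?addr0 //.
      move=> [T' S'] /= /andP[l']; rewrite xpair_eqE => ne.
      by rewrite linearZ /= EP // [T == _]eq_sym [S == _]eq_sym (negPf ne) mulr0.
    rewrite rep_unlinked // big1 // => -[T' S'] /= l'.
    rewrite linearZ /= EP //; case: andP => [[/eqP ET /eqP ES]|_].
      by rewrite ET ES l' in lTS.
    by rewrite mulr0.
  apply: memv_suml => -[T S] /= lTS; apply: memvZ.
  by rewrite memvE; apply: (sumv_sup (T, S)).
Qed.
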